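(* Let $n=1+n_2+n_3=p+q$ with $n_2,n_3,p,q$ positive integers, let $G=U(n)$, and let $L=U(1)\times U(n_2)\times U(n_3)$ and $H=U(p)\times U(q)$ be the natural block-diagonal subgroups of $G$. Set $l:=\min(2p,2q,2n_2+1,2n_3+1)$ (so $[\tfrac l2]=\min(p,q,n_2,n_3)$ and $[\tfrac{l+1}2]=\min(p,q,n_2+1,n_3+1)$). Define the abelian subspaces of $\mathfrak{u}(n)$ $$\mathfrak b':=\sum_{i=1}^{[\frac{l+1}2]}\mathbb{R}(E_{i,n+1-i}-E_{n+1-i,i}),\qquad \mathfrak b'':=\sum_{i=1}^{[\frac l2]}\mathbb{R}(E_{i+1,n+1-i}-E_{n+1-i,i+1}),$$ the toral subgroups $B':=\exp\mathfrak b'$ and $B'':=\exp\mathfrak b''$ of $O(n)$, and the subset $B:=B''B'=\{xy:x\in B'',y\in B'\}\subset O(n)$. Then $G=LBH$.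
   Context: $E_{ij}$ denotes the $n\times n$ matrix unit with $1$ in position $(i,j)$ and $0$ elsewhere; $[x]$ denotes the integer part of $x$. $LBH=\{xbh:x\in L,b\in B,h\in H\}$. *)

(* Defs.v *)
From mathcomp Require Import all_boot all_order all_algebra.
From mathcomp Require Import all_classical all_reals all_analysis.
From mathcomp Require Export complex.
Import numFieldNormedType.Exports.

Set Implicit Arguments.
Unset Strict Implicit.
Unset Printing Implicit Defensive.

Local Open Scope ring_scope.

Definition Eunit (R : nzRingType) (n i j : nat) : 'M[R]_n :=
  \matrix_(a < n, b < n) ((a.+1 == i) && (b.+1 == j))%:R.

Definition expm (R : realType) (n : nat) (A : 'M[R]_n) : 'M[R]_n :=
  \matrix_(a < n, b < n)
     limn (fun N : nat => (\sum_(k < N) (k`!%:R)^-1 *: (A ^+ k)) a b).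

Definition cplx_mx (R : realType) (n : nat) (A : 'M[R]_n) : 'M[R[i]]_n :=
  map_mx (fun x : R => real_complex R x) A.

Definition adjmx (R : realType) (n : nat) (A : 'M[R[i]]_n) : 'M[R[i]]_n :=
  (map_mx (@conjc R) A)^T.

Definition unitary (R : realType) (n : nat) (g : 'M[R[i]]_n) : Prop :=
  g *m adjmx g = 1%:M.

(* Block index of a 0-based row/column index for the block decomposition
   of sizes (1, n2, n3), resp. (p, q). *)
Definition blockL (n2 : nat) (a : nat) : nat :=
  if (a < 1)%N then 0%N else if (a < 1 + n2)%N then 1%N else 2%N.
Definition blockH (p : nat) (a : nat) : nat :=
  if (a < p)%N then 0%N else 1%N.

Definition block_diag (R : nzRingType) (n : nat) (blk : nat -> nat)
    (g : 'M[R]_n) : Prop :=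
  forall a b : 'I_n, blk a <> blk b -> g a b = 0.

Definition Lgrp (R : realType) (n n2 : nat) (g : 'M[R[i]]_n) : Prop :=
  unitary g /\ block_diag (blockL n2) g.
Definition Hgrp (R : realType) (n p : nat) (g : 'M[R[i]]_n) : Prop :=
  unitary g /\ block_diag (blockH p) g.

Definition lpar (n2 n3 p q : nat) : nat :=
  minn (minn p.*2 q.*2) (minn n2.*2.+1 n3.*2.+1).

(* Elements of b' : sum_{i=1}^{[(l+1)/2]} t_i (E_{i,n+1-i} - E_{n+1-i,i}),
   written with i = k+1, k < [(l+1)/2]. *)
Definition bprime_elt (R : realType) (n l : nat) (t : 'I_(l.+1)./2 -> R)
    : 'M[R]_n :=
  \sum_(k < (l.+1)./2)
     t k *: (Eunit R n k.+1 (n - k) - Eunit R n (n - k) k.+1).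

Definition bsecond_elt (R : realType) (n l : nat) (t : 'I_(l./2) -> R)
    : 'M[R]_n :=
  \sum_(k < l./2)
     t k *: (Eunit R n k.+2 (n - k) - Eunit R n (n - k) k.+2).

Definition Bprime (R : realType) (n l : nat) (x : 'M[R[i]]_n) : Prop :=
  exists t : 'I_(l.+1)./2 -> R, x = cplx_mx (expm (bprime_elt n t)).
Definition Bsecond (R : realType) (n l : nat) (x : 'M[R[i]]_n) : Prop :=
  exists t : 'I_(l./2) -> R, x = cplx_mx (expm (bsecond_elt n t)).
Definition Bset (R : realType) (n l : nat) (b : 'M[R[i]]_n) : Prop :=
  exists x y, Bsecond l x /\ Bprime l y /\ b = x *m y.

(* Main.v *)
(** Work with matrices that are the identity outside the index window
    [j, n - j), 0-based.  Multiplying on the right by H makes row j equal to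
    cos(t) e_j + sin(t) e_(n-1-j), and a rotation of B' in that plane turns it
    into e_j.  Then multiplying on the left by L makes column n-1-j lie in the
    plane of e_(j+1) and e_(n-1-j), and a rotation of B'' turns it into
    e_(n-1-j).  What is left is the identity outside [j+1, n-j-1).  The factors
    collected from the smaller window commute with the two rotations because
    their supports are disjoint, so they can be regrouped as L B'' B' H.  The
    descent stops as soon as the window lies in one block of H, or, after the
    first half of a step, in one block of L. *)
Require Import Defs.
From mathcomp Require Import all_boot all_order all_algebra.
From mathcomp Require Import all_classical all_reals all_analysis.
From mathcomp Require Import complex.
From mathcomp Require Import ring lra zify.
Import Order.TTheory GRing.Theory Num.Theory numFieldNormedType.Exports.

Set Implicit Arguments.
Unset Strict Implicit.
Unset Printing Implicit Defensive.

Local Open Scope ring_scope.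

(** * Rotations in the planes of an involution, and their exponentials *)

Section Givens.
Variables (R : realType) (n : nat) (s : 'I_n -> 'I_n).
Hypothesis sK : involutive s.

Definition antisym (f : 'I_n -> R) := forall a, f (s a) = - f a.

(** All plane rotations attached to the orbits of [s] at once. At a fixed point of [s] an
    antisymmetric [f] vanishes, so the diagonal entry there is 1. *)
Definition givens (f : 'I_n -> R) : 'M[R]_n :=
  \matrix_(a, b) (cos (f a) *+ (a == b) + sin (f a) *+ (s a == b)).

Lemma givens0 f : (forall a, f a = 0) -> givens f = 1%:M.
Proof.
by move=> f0; apply/matrixP => a b; rewrite !mxE f0 cos0 sin0 mul0rn addr0.
Qed.

Lemma row_givens f a :
  row a (givens f) = cos (f a) *: delta_mx 0 a + sin (f a) *: delta_mx 0 (s a).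
Proof.
by apply/rowP => b; rewrite !mxE /= !mulr_natr ![b == _]eq_sym.
Qed.

Lemma givensD f g : antisym g ->
  givens f *m givens g = givens (fun a => f a + g a).
Proof.
move=> ag; apply/row_matrixP => a; rewrite row_mul !row_givens mulmxDl.
rewrite -!scalemxAl -!rowE !row_givens sK ag cosN sinN cosD sinD.
by apply/rowP => b; rewrite !mxE; ring.
Qed.

Lemma tr_givens f : antisym f -> (givens f)^T = givens (fun a => - f a).
Proof.
move=> af; apply/matrixP => a b; rewrite !mxE cosN sinN.
have -> : (s b == a) = (s a == b) by rewrite -(inj_eq (can_inj sK)) sK eq_sym.
rewrite [b == a]eq_sym; congr (_ + _); last first.
  by case: (eqVneq (s a) b) => [<-|_]; rewrite ?af ?sinN ?mulr0n.
by case: (eqVneq a b) => [->|_]; rewrite ?mulr0n.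
Qed.

Lemma givens_orthogonal f : antisym f -> givens f *m (givens f)^T = 1%:M.
Proof.
move=> af; rewrite tr_givens // givensD => [|a]; last by rewrite af.
by apply: givens0 => a; rewrite subrr.
Qed.

(** The square of this matrix is diagonal with entries - (f a)^2, so even powers sit on the diagonal
    and odd powers on the graph of [s]. *)
Lemma antisym_mx_exp f k : antisym f ->
  (\matrix_(a, b) (f a *+ (s a == b)) : 'M[R]_n) ^+ k =
  \matrix_(a, b) ((-1) ^+ k./2 * f a ^+ k *+ ((if odd k then s a else a) == b)).
Proof.
move=> af; elim: k => [|k IH].
  by apply/matrixP => a b; rewrite expr0 !mxE mul1r.
apply/matrixP => a b; rewrite exprS IH mxE (bigD1 (s a)) //= big1 => [|c ca].
  rewrite !mxE eqxx addr0 mulr1n af (exprNn (f a)) sK mulrnAr /= uphalf_half exprD.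
  rewrite -[X in X * f a ^+ k]signr_odd exprS.
  by case: (odd k) => /=; congr (_ *+ _); rewrite ?expr1 ?expr0; ring.
by rewrite !mxE eq_sym (negPf ca) mul0r.
Qed.

(** Even powers build the cosine series on the diagonal, odd powers the sine series on the graph of
    [s]. *)
Lemma expm_antisym f : antisym f ->
  expm (\matrix_(a, b) (f a *+ (s a == b))) = givens f.
Proof.
move=> af; apply/matrixP => a b; rewrite !mxE; apply: cvg_lim => //.
have -> : (fun N => (\sum_(k < N) (k`!%:R)^-1 *:
    ((\matrix_(c, d) (f c *+ (s c == d)) : 'M[R]_n) ^+ k)) a b) =
  (fun N => series (cos_coeff (f a)) N * (a == b)%:R +
            series (sin_coeff (f a)) N * (s a == b)%:R).
  apply/funext => N; rewrite summxE /series /= !big_mkord !mulr_suml -big_split.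
  apply: eq_bigr => k _; rewrite antisym_mx_exp // !mxE /=.
  rewrite cos_coeffE sin_coeffE mulrnAr -[_ *+ (_ == b)]mulr_natr.
  have [ok|ek] := boolP (odd k) => /=; last by ring.
  have -> : k.-1./2 = k./2; last by ring.
  by case: (nat_of_ord k) ok => //= m /negPf om; rewrite uphalf_half om.
rewrite -[cos _ *+ _]mulr_natr -[sin _ *+ _]mulr_natr.
apply: cvgD; apply: cvgMr_tmp; rewrite unlock.
  exact: is_cvg_series_cos_coeff.
exact: is_cvg_series_sin_coeff.
Qed.

End Givens.

(** * Unitary matrices, supports, and alignment of a unit row *)

Section Unitary.
Variables (R : realType) (n : nat).
Implicit Types (g h A B : 'M[R[i]]_n) (S T : pred 'I_n).

Lemma adjmxM A B : adjmx (A *m B) = adjmx B *m adjmx A.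
Proof. by rewrite /adjmx map_mxM trmx_mul. Qed.

Lemma adjmxK A : adjmx (adjmx A) = A.
Proof. by apply/matrixP => a b; rewrite !mxE conjcK. Qed.

Lemma unitaryM g h : unitary g -> unitary h -> unitary (g *m h).
Proof.
by move=> ug uh; rewrite /unitary adjmxM mulmxA -(mulmxA g) uh mulmx1.
Qed.

Lemma unitary_mulVmx g : unitary g -> adjmx g *m g = 1%:M.
Proof. exact: mulmx1C. Qed.

Lemma unitary_adjmx g : unitary g -> unitary (adjmx g).
Proof. by move=> ug; rewrite /unitary adjmxK unitary_mulVmx. Qed.

Lemma unitary1 : unitary (1%:M : 'M[R[i]]_n).
Proof. by rewrite /unitary /adjmx map_mx1 trmx1 mulmx1. Qed.

Lemma unitary_mulmxK g A : unitary g -> A *m g *m adjmx g = A.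
Proof. by move=> ug; rewrite -mulmxA ug mulmx1. Qed.

Lemma unitary_mulmxKV g A : unitary g -> A *m adjmx g *m g = A.
Proof. by move=> ug; rewrite -mulmxA unitary_mulVmx // mulmx1. Qed.

Definition supported S g :=
  forall a b, ~~ (S a && S b) -> g a b = (a == b)%:R.

Lemma supported1 S : supported S 1%:M.
Proof. by move=> a b _; rewrite mxE. Qed.

Lemma supported_sub S T g :
  (forall a, S a -> T a) -> supported S g -> supported T g.
Proof.
move=> ST gS a b nT; apply: gS; apply: contra nT => /andP[Sa Sb].
by rewrite !ST.
Qed.

Lemma supported_adjmx S g : supported S g -> supported S (adjmx g).
Proof.
by move=> gS a b nS; rewrite !mxE gS 1?andbC // rmorph_nat eq_sym.
Qed.

Lemma supportedM S g h :
  supported S g -> supported S h -> supported S (g *m h).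
Proof.
move=> gS hS a b nS; rewrite mxE; have [Sa|Sa] := boolP (S a).
  have Sb : ~~ S b by move: nS; rewrite Sa.
  rewrite (bigD1 b) //= big1 ?addr0 => [|c cb].
    by rewrite hS ?(negPf Sb) ?andbF // eqxx mulr1 gS.
  by rewrite hS ?(negPf Sb) ?andbF // (negPf cb) mulr0.
rewrite (bigD1 a) //= big1 ?addr0 => [|c ca].
  by rewrite gS ?(negPf Sa) // eqxx mul1r hS.
by rewrite gS ?(negPf Sa) // eq_sym (negPf ca) mul0r.
Qed.

(** Disjoint supports give (g - 1)(h - 1) = 0 = (h - 1)(g - 1); expanding both products yields gh =
    hg. *)
Lemma supported_comm S T g h : (forall a, ~~ (S a && T a)) ->
  supported S g -> supported T h -> g *m h = h *m g.
Proof.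
move=> ST gS hT.
have gh0 S' T' g' h' : (forall a, ~~ (S' a && T' a)) ->
    supported S' g' -> supported T' h' -> (g' - 1%:M) *m (h' - 1%:M) = 0.
  move=> ST' gS' hT'; apply/matrixP => a b; rewrite !mxE big1 // => c _.
  have := ST' c; rewrite negb_and => /orP[nc|nc].
    by rewrite !mxE gS' ?(negPf nc) ?andbF // subrr mul0r.
  by rewrite !mxE hT' ?(negPf nc) // subrr mulr0.
have /eqP := gh0 _ _ _ _ ST gS hT.
have /eqP := gh0 _ _ _ _ (fun a => etrans (congr1 negb (andbC _ _)) (ST a)) hT gS.
rewrite !mulmxBl !mulmxBr !mulmx1 !mul1mx => /eqP/subr0_eq hg /eqP/subr0_eq gh.
rewrite -[g *m h](subrK g) gh -[h *m g](subrK h) hg.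
by rewrite addrAC [RHS]addrAC (addrC h).
Qed.

(* A unit row of a unitary matrix forces the corresponding column to be a unit
   vector as well. *)
Lemma supportedD1 S g i : unitary g -> supported S g ->
  row i g = delta_mx 0 i -> supported (predD1 S i) g.
Proof.
move=> ug gS gi.
have gi' : col i g = delta_mx i 0.
  have : row i (adjmx g) = delta_mx 0 i.
    by rewrite rowE -gi -row_mul ug row1.
  move=> /rowP e; apply/colP => a; have := congr1 (@conjc R) (e a).
  by rewrite !mxE conjcK /= rmorph_nat andbT.
move=> a b nS; have [->|ai] := eqVneq a i.
  by move/rowP: gi => /(_ b); rewrite !mxE eq_sym.
have [->|bi] := eqVneq b i.
  by move/colP: gi' => /(_ a); rewrite !mxE andbT.
by apply: gS; move: nS; rewrite /= ai bi.
Qed.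

Definition hdot (u w : 'rV[R[i]]_n) : R[i] := \sum_k u 0 k * conjc (w 0 k).

(** The Householder reflection, acting on row vectors from the right. For w = 0 the convention 1 / 0
    = 0 makes it the identity. *)
Definition reflection (w : 'rV[R[i]]_n) : 'M[R[i]]_n :=
  1%:M - (2 / hdot w w) *: ((map_mx (@conjc R) w)^T *m w).

Lemma mul_adj_hdot u w : u *m (map_mx (@conjc R) w)^T = (hdot u w)%:M.
Proof.
apply/matrixP => a b; rewrite !ord1 !mxE mulr1n.
by apply: eq_bigr => k _; rewrite !mxE.
Qed.

Lemma mul_reflection u w :
  u *m reflection w = u - (2 / hdot w w * hdot u w) *: w.
Proof.
by rewrite mulmxBr mulmx1 -scalemxAr mulmxA mul_adj_hdot mul_scalar_mx scalerA.
Qed.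

Lemma conjc_hdot w : conjc (hdot w w) = hdot w w.
Proof.
rewrite rmorph_sum; apply: eq_bigr => k _.
by rewrite rmorphM /= conjcK mulrC.
Qed.

Lemma unitary_reflection w : unitary (reflection w).
Proof.
rewrite /unitary; have ->: adjmx (reflection w) = reflection w.
  have ck : conjc (2 / hdot w w) = 2 / hdot w w.
    by rewrite fmorph_div; congr (_ / _); [exact: conjc_nat|exact: conjc_hdot].
  apply/matrixP => a b; rewrite /reflection; move: (2 / _) ck => k ck.
  rewrite !mxE !big_ord1 !mxE rmorphB !rmorphM /= conjcK ck rmorph_nat eq_sym.
  by rewrite [_ * w _ _]mulrC.
have [d0|d0] := eqVneq (hdot w w) 0.
  by rewrite /reflection d0 invr0 mulr0 scale0r subr0 mulmx1.
rewrite {1}/reflection mulmxBl mul1mx -scalemxAl -mulmxA mul_reflection.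
rewrite divfK // mulmxBr -scalemxAr /reflection -[RHS]subr0.
rewrite -addrA; congr (_ + _); rewrite -opprD; congr (- _).
rewrite -scalerDr; apply/eqP; rewrite scaler_eq0; apply/orP; right.
by apply/eqP/matrixP => a b; rewrite !mxE; ring.
Qed.

Lemma hdotM u w h : unitary h -> hdot (u *m h) (w *m h) = hdot u w.
Proof.
move=> uh; have := mul_adj_hdot (u *m h) (w *m h).
rewrite map_mxM trmx_mul mulmxA -(mulmxA u) uh mulmx1 mul_adj_hdot.
by move=> /matrixP/(_ 0 0); rewrite !mxE.
Qed.

Lemma hdot_eq0 w : hdot w w = 0 -> w = 0.
Proof.
move=> /eqP; rewrite psumr_eq0 => [/allP w0|k _]; last exact: mulcJ_ge0.
apply/rowP => k; rewrite mxE; apply/eqP.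
have := w0 k (mem_index_enum k).
by rewrite /= mulf_eq0 conjc_eq0 orbb.
Qed.

Lemma mul_supported S (u : 'rV[R[i]]_n) h k : supported S h -> ~~ S k -> (u *m h) 0 k = u 0 k.
Proof.
move=> hS nk; rewrite mxE (bigD1 k) //= big1 => [|c ck].
  by rewrite hS ?(negPf nk) // eqxx mulr1 addr0.
by rewrite hS ?(negPf nk) ?andbF // (negPf ck) mulr0.
Qed.

Lemma unitary_phase (i : 'I_n) (u : 'rV[R[i]]_n) :
  exists h, [/\ unitary h, supported (pred1 i) h & 0 <= (u *m h) 0 i].
Proof.
have [a [a1 ua]] : exists a : R[i], a * conjc a = 1 /\ 0 <= u 0 i * a.
  have [u0|u0] := eqVneq (u 0 i) 0.
    by exists 1; rewrite u0 mul0r conjc1 mulr1.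
  have n0 : `|u 0 i| != 0 by rewrite normr_eq0.
  (* This phase turns u_i into its modulus. *)
  exists (conjc (u 0 i) / `|u 0 i|); split; last first.
    by rewrite mulrA -sqr_normc expr2 mulfK.
  have cn : conjc `|u 0 i| = `|u 0 i| by rewrite normc_def conjc_real.
  have -> : conjc (conjc (u 0 i) / `|u 0 i|) = u 0 i / `|u 0 i|.
    by rewrite fmorph_div; congr (_ / _); [exact: conjcK|exact: cn].
  rewrite mulrACA -invfM [_ * u 0 i]mulrC -sqr_normc -expr2.
  by rewrite divff // expf_neq0.
pose d : 'rV[R[i]]_n := \row_k (if k == i then a else 1).
exists (diag_mx d); split.
- apply/matrixP => b c; rewrite mul_diag_mx !mxE.
  rewrite [c == b]eq_sym; case: (eqVneq b c) => [->|_]; last by rewrite mulr0n rmorph0 mulr0.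
  by case: eqP => _; rewrite mulr1n ?a1 // conjc1 mulr1.
- move=> b c; rewrite !mxE /=; case: (eqVneq b c) => [->|_]; last by [].
  by rewrite andbb => /negPf ->.
- by rewrite mul_mx_diag !mxE eqxx.
Qed.

(* After a phase makes u_i >= 0, reflect in w = u_S - |u_S| e_i. *)
Lemma unitary_align S (i : 'I_n) (u : 'rV[R[i]]_n) : S i ->
  exists h, [/\ unitary h, supported S h, 0 <= (u *m h) 0 i &
    forall k, S k -> k != i -> (u *m h) 0 k = 0].
Proof.
move=> Si; have [D [uD DS]] := unitary_phase i u.
move=> vi; suff [w [wS wi wk]] : exists w, [/\ supported S (reflection w),
    0 <= (u *m D *m reflection w) 0 i &
    forall k, S k -> k != i -> (u *m D *m reflection w) 0 k = 0].
  exists (D *m reflection w); rewrite mulmxA; split=> //.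
    exact: unitaryM uD (unitary_reflection w).
  by apply: supportedM => //; apply: supported_sub DS => a /eqP->.
move: (u *m D) vi => v vi {u uD DS}.
pose N := sqrtC (\sum_(k | S k) v 0 k * conjc (v 0 k)).
have N0 : 0 <= N by rewrite sqrtC_ge0; apply: sumr_ge0 => k _; exact: mulcJ_ge0.
have NN : \sum_(k | S k) v 0 k * conjc (v 0 k) = N * N by rewrite -expr2 sqrtCK.
have conj_ge0 (z : R[i]) : 0 <= z -> conjc z = z.
  by case: z => a b; rewrite lecE /= => /andP[/eqP-> _]; rewrite oppr0.
have cN := conj_ge0 _ N0; have cv := conj_ge0 _ vi.
pose w : 'rV[R[i]]_n := \row_k (if S k then v 0 k - N *+ (k == i) else 0).
have vw : hdot v w = N * N - N * v 0 i.
  rewrite -NN /hdot (bigID S) /= [X in _ + X]big1 ?addr0; last first.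
    by move=> k /negPf nk; rewrite !mxE nk conjc0 mulr0.
  rewrite (bigD1 i) //= [in RHS](bigD1 i) //= !mxE Si eqxx rmorphB /= cN cv.
  rewrite (eq_bigr (fun k => v 0 k * conjc (v 0 k))); first by ring.
  by move=> k /andP[Sk /negPf ki]; rewrite !mxE Sk ki subr0.
(* This needs N and v_i real. It makes the reflection send v to v - w, which is N e_i on S and v off
   S. *)
have ww : hdot w w = 2 * hdot v w.
  have -> : hdot w w = hdot v w - N * conjc (w 0 i).
    rewrite /hdot (bigD1 i) //= [in RHS](bigD1 i) //= !mxE Si eqxx addrAC.
    rewrite -mulrBl; congr (_ + _); apply: eq_bigr => k /negPf ki.
    by rewrite !mxE; case: (S k); rewrite ?ki ?subr0 // conjc0 !mulr0.
  by rewrite vw !mxE Si eqxx rmorphB /= cN cv; ring.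
have vh : v *m reflection w = v - w.
  rewrite mul_reflection; have [d0|d0] := eqVneq (hdot w w) 0.
    by rewrite (hdot_eq0 d0) scaler0.
  rewrite {1}ww invfM mulrA divff ?pnatr_eq0 // mul1r mulVf ?scale1r //.
  by apply: contra d0; rewrite ww => /eqP->; rewrite mulr0.
exists w; rewrite vh; split.
- move=> a b; rewrite negb_and !mxE big_ord1 !mxE.
  by case/orP => /negPf->; rewrite ?conjc0 ?mul0r ?mulr0 subr0.
- by rewrite !mxE Si eqxx opprB addrC subrK.
- by move=> k Sk /negPf ki; rewrite !mxE Sk ki subr0 subrr.
Qed.

(** The order on [R[i]] makes nonnegative numbers real, so (c, s) lies on the unit circle and t =
    acos c works; s >= 0 selects the right root for sin t. *)
Lemma polar_angle (c s : R[i]) : 0 <= c -> 0 <= s ->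
  c * conjc c + s * conjc s = 1 ->
  exists t : R, c = real_complex R (cos t) /\ s = real_complex R (sin t).
Proof.
case: c s => [c c'] [s s']; rewrite !lecE /= => /andP[/eqP-> c0] /andP[/eqP-> s0].
rewrite !oppr0; simpc; move=> [cs].
have c1 : -1 <= c <= 1 by nra.
exists (acos c); rewrite sin_acos // acosK ?in_itv //.
by rewrite (_ : 1 - c ^+ 2 = s ^+ 2) ?sqrtr_sqr ?ger0_norm // -cs; ring.
Qed.

(** Align the part of u on S with e_i, then the part on T with e_j; by disjointness the second step
    keeps the first. Two nonnegative coordinates of total norm 1 remain. *)
Lemma unit_row_align S T (i j : 'I_n) (u : 'rV[R[i]]_n) :
  (forall a, ~~ (S a && T a)) -> S i -> T j ->
  (forall k, ~~ S k -> ~~ T k -> u 0 k = 0) -> hdot u u = 1 ->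
  exists h1 h2 t, [/\ unitary h1 /\ supported S h1, unitary h2 /\ supported T h2 &
    u *m (h1 *m h2) = real_complex R (cos t) *: delta_mx 0 i
                    + real_complex R (sin t) *: delta_mx 0 j].
Proof.
move=> ST Si Tj u0 uu.
have [h1 [uh1 h1S ci ck]] := unitary_align u Si.
have [h2 [uh2 h2T sj sk]] := unitary_align (u *m h1) Tj.
have nTi : ~~ T i by have := ST i; rewrite Si.
have ij : j != i by apply: contraTneq Tj => ->.
set v := u *m h1 *m h2 in sj sk.
have v0 (k : 'I_n) : k != i -> k != j -> v 0 k = 0.
  move=> ki kj; have [Tk|nTk] := boolP (T k); first exact: sk.
  rewrite (mul_supported _ h2T nTk); have [Sk|nSk] := boolP (S k); first exact: ck.
  by rewrite (mul_supported _ h1S nSk) u0.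
have vi : 0 <= v 0 i by rewrite (mul_supported _ h2T nTi).
have vv : v 0 i * conjc (v 0 i) + v 0 j * conjc (v 0 j) = 1.
  rewrite -uu -(hdotM u u uh1) -(hdotM _ _ uh2) -/v /hdot.
  rewrite (bigD1 i) //= (bigD1 j) //= big1 ?addr0 // => k /andP[ki kj].
    by rewrite (v0 k) ?mul0r.
have [t [ct st]] := polar_angle vi sj vv.
exists h1, h2, t; split=> //; rewrite mulmxA -/v; clearbody v; rewrite -ct -st.
apply/rowP => k; rewrite !mxE /=.
have [->|ki] := eqVneq k i; first by rewrite eq_sym (negPf ij) mulr1 mulr0 addr0.
have [->|kj] := eqVneq k j; first by rewrite mulr1 mulr0 add0r.
by rewrite v0 // !mulr0 addr0.
Qed.

Lemma adjmx_cplx (B : 'M[R]_n) : adjmx (cplx_mx B) = cplx_mx B^T.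
Proof. by apply/matrixP => a b; rewrite !mxE conjc_real. Qed.

Lemma cplx_mxM (A B : 'M[R]_n) : cplx_mx (A *m B) = cplx_mx A *m cplx_mx B.
Proof. exact: map_mxM. Qed.

Lemma unitary_cplx (B : 'M[R]_n) : B *m B^T = 1%:M -> unitary (cplx_mx B).
Proof. by move=> BB; rewrite /unitary adjmx_cplx -cplx_mxM BB /cplx_mx map_mx1. Qed.

(** The angle depends on g alone, and any B with the stated row i may then be used: row i of g h1 h2
    equals that of B, so multiplying by the adjoint of B leaves e_i. Used for B' on g and for B'' on
    an adjoint. *)
Lemma unitary_peel S T (i j : 'I_n) g :
  (forall a, ~~ (S a && T a)) -> S i -> T j ->
  unitary g -> supported (predU S T) g ->
  exists h1 h2 t, [/\ unitary h1 /\ supported S h1, unitary h2 /\ supported T h2 &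
    forall B : 'M[R]_n, unitary (cplx_mx B) -> supported (predU S T) (cplx_mx B) ->
      row i B = cos t *: delta_mx 0 i + sin t *: delta_mx 0 j ->
      supported (predD1 (predU S T) i) (g *m (h1 *m h2) *m adjmx (cplx_mx B))].
Proof.
move=> ST Si Tj ug gS.
have [| |h1 [h2 [t [[uh1 h1S] [uh2 h2T] gh]]]] := @unit_row_align S T i j (row i g) ST Si Tj.
- move=> k nS nT; rewrite mxE gS /=; last by rewrite (negPf nS) (negPf nT) andbF.
  by case: eqVneq => // ik; rewrite -ik Si in nS.
- have /matrixP/(_ i i) := ug; rewrite !mxE eqxx mulr1n => <-.
  by apply: eq_bigr => k _; rewrite !mxE.
exists h1, h2, t; split=> // B uB BS rB.
have h1U : supported (predU S T) h1 by apply: supported_sub h1S => a /= ->.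
have h2U : supported (predU S T) h2 by apply: supported_sub h2T => a /= ->; rewrite orbT.
apply: supportedD1.
- by apply: unitaryM; [apply: unitaryM => //; exact: unitaryM|exact: unitary_adjmx].
- by do ![apply: supportedM => //]; exact: supported_adjmx.
rewrite !row_mul gh.
have -> : real_complex R (cos t) *: delta_mx 0 i + real_complex R (sin t) *: delta_mx 0 j
    = row i (cplx_mx B).
  by rewrite -map_row rB map_mxD !map_mxZ !map_delta_mx.
by rewrite -row_mul uB row1.
Qed.

End Unitary.

(** * Block-diagonal matrices *)

Section BlockGroups.
Variables (R : realType) (n : nat) (blk : nat -> nat).
Implicit Types g h : 'M[R[i]]_n.

Lemma block_diagM g h :
  block_diag blk g -> block_diag blk h -> block_diag blk (g *m h).
Proof.
move=> bg bh a b ab; rewrite mxE big1 // => c _.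
have [ac|/eqP ac] := eqVneq (blk a) (blk c); last by rewrite bg ?mul0r.
by rewrite bh ?mulr0 // -ac.
Qed.

Lemma block_diag_adjmx g : block_diag blk g -> block_diag blk (adjmx g).
Proof. by move=> bg a b ab; rewrite !mxE bg ?conjc0 //; exact/nesym. Qed.

Lemma block_diag_supported (S : pred 'I_n) g :
  (forall a b, S a -> S b -> blk a = blk b) -> supported S g -> block_diag blk g.
Proof.
move=> Sblk gS a b ab; rewrite gS; last by apply/negP => /andP[Sa Sb]; exact/ab/Sblk.
by case: eqVneq => // e; rewrite e in ab.
Qed.

Lemma block_diag1 : block_diag blk (1%:M : 'M[R[i]]_n).
Proof. exact: (@block_diag_supported pred0) (@supported1 _ _ _). Qed.

End BlockGroups.

(** * The tori B' and B'' as families of rotations *)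

Section Tori.
Variables (R : realType) (n : nat).
Implicit Types (s t : nat -> R).

(* The pairing of B'' in 0-based indices is a <-> n - a for a > 0; index 0 is
   left fixed because [insubd] falls back to [a] when [n - a] is not below n. *)
Definition mirror (a : 'I_n) : 'I_n := insubd a (n - a)%N.

Lemma val_mirror (a : 'I_n) : val (mirror a) = if (0 < a)%N then (n - a)%N else a.
Proof.
rewrite val_insubd /=; move: (ltn_ord a); case: (nat_of_ord a) => [|k] kn /=.
  by rewrite subn0 ltnn.
by rewrite ifT //; lia.
Qed.

Lemma mirrorK : involutive mirror.
Proof.
move=> a; apply/val_inj; rewrite !val_mirror /=; move: (ltn_ord a).
by case: (nat_of_ord a) => //= k kn; rewrite ifT; lia.
Qed.

(* The angle in row a is t_k, minus t_k, or 0, according to whether a is the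
   first index of the k-th pair, its second index, or neither; as at most one
   of the two terms is nonzero for the t that matter, a difference encodes it. *)
Definition angle1 t (a : 'I_n) : R := t a - t (rev_ord a).
Definition angle2 s (a : 'I_n) : R :=
  if val a is k.+1 then s k - s (n - k.+2)%N else 0.

Definition rot1 t := givens (@rev_ord n) (angle1 t).
Definition rot2 s := givens mirror (angle2 s).

Lemma antisym_angle1 t : antisym (@rev_ord n) (angle1 t).
Proof. by move=> a; rewrite /angle1 rev_ordK opprB. Qed.

Lemma antisym_angle2 s : antisym mirror (angle2 s).
Proof.
move=> a; rewrite /angle2 val_mirror /=; have := ltn_ord a.
case: (nat_of_ord a) => [|k] kn /=; first by rewrite oppr0.
have -> : (n - k.+1 = (n - k.+2).+1)%N by lia.
by rewrite opprB; congr (s _ - s _); lia.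
Qed.

Lemma rot1D t t' : rot1 t *m rot1 t' = rot1 (fun k => t k + t' k).
Proof.
rewrite /rot1 givensD; [|exact: rev_ordK|exact: antisym_angle1].
by congr givens; apply/funext => a; rewrite /angle1; ring.
Qed.

Lemma rot2D s s' : rot2 s *m rot2 s' = rot2 (fun k => s k + s' k).
Proof.
rewrite /rot2 givensD; [|exact: mirrorK|exact: antisym_angle2].
congr givens; apply/funext => a; rewrite /angle2.
by case: (val a) => [|k]; ring.
Qed.

Lemma rot1_0 t : (forall k, t k = 0) -> rot1 t = 1%:M.
Proof. by move=> t0; apply: givens0 => a; rewrite /angle1 !t0 subrr. Qed.

Lemma rot2_0 s : (forall k, s k = 0) -> rot2 s = 1%:M.
Proof.
by move=> s0; apply: givens0 => a; rewrite /angle2; case: (val a) => // k; rewrite !s0 subrr.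
Qed.

Lemma unitary_rot1 t : unitary (cplx_mx (rot1 t)).
Proof. by apply/unitary_cplx/givens_orthogonal; [exact: rev_ordK|exact: antisym_angle1]. Qed.

Lemma unitary_rot2 s : unitary (cplx_mx (rot2 s)).
Proof. by apply/unitary_cplx/givens_orthogonal; [exact: mirrorK|exact: antisym_angle2]. Qed.

Lemma supported_givens (S : pred 'I_n) (r : 'I_n -> 'I_n) (f : 'I_n -> R) :
  antisym r f -> (forall a, ~~ S a -> f a = 0) ->
  supported S (cplx_mx (givens r f)).
Proof.
move=> fr fS a b; rewrite negb_and !mxE => /orP[Sa|Sb].
  by rewrite fS // cos0 sin0 mul0rn addr0 rmorph_nat.
have [ab|ab] := eqVneq a b.
  by rewrite ab fS // cos0 sin0 mul0rn addr0 rmorph_nat.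
rewrite mulr0n add0r; have [rb|_] := eqVneq (r a) b; last by rewrite rmorph0.
(* Here b = r a lies off S, so f b = 0, and antisymmetry gives f a = 0. *)
have := fr a; rewrite rb fS // => /eqP; rewrite eq_sym oppr_eq0 => /eqP ->.
by rewrite sin0 rmorph0.
Qed.

Definition extend0 m (t : 'I_m -> R) (k : nat) : R :=
  if insub k is Some i then t i else 0.

Lemma sum_delta m (t : 'I_m -> R) x :
  \sum_(k < m) t k *+ (k == x :> nat) = extend0 t x.
Proof.
rewrite /extend0; case: insubP => [i _ <-|nx].
  by rewrite (bigD1 i) //= eqxx big1 ?addr0 // => k /negPf ki; rewrite (inj_eq val_inj) ki.
rewrite big1 // => k _; case: eqP => // kx; move: nx; rewrite -kx ltn_ord //.
Qed.

Lemma extend0_id m t : (forall k, (m <= k)%N -> t k = 0) ->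
  extend0 (fun k : 'I_m => t k) = t.
Proof.
move=> t0; apply/funext => k; rewrite /extend0; case: insubP => [i _ <- //|].
by rewrite -leqNgt => /t0.
Qed.

(** This holds for every l: overlapping pairs subtract in [angle1] just as in the sum, and terms
    with k >= n are zero matrices. *)
Lemma expm_bprime l (t : 'I_(l.+1)./2 -> R) :
  expm (bprime_elt n t) = rot1 (extend0 t).
Proof.
rewrite /rot1 -expm_antisym; [|exact: rev_ordK|exact: antisym_angle1].
congr expm; apply/matrixP => a b; rewrite /bprime_elt summxE mxE.
rewrite /angle1 -!sum_delta -sumrB -sumrMnl; apply: eq_bigr => k _; rewrite !mxE.
have [an bn] := (ltn_ord a, ltn_ord b).
have -> : (a.+1 == k.+1) && (b.+1 == (n - k)%N) = (k == a :> nat) && (rev_ord a == b).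
  by rewrite -(inj_eq val_inj) /=; lia.
have -> : (a.+1 == (n - k)%N) && (b.+1 == k.+1) =
    (k == rev_ord a :> nat) && (rev_ord a == b).
  by rewrite -(inj_eq val_inj) /=; lia.
by case: (rev_ord a == b); rewrite ?andbT ?andbF ?subrr ?mulr0 // mulrBr !mulr_natr.
Qed.

Lemma expm_bsecond l (s : 'I_(l./2) -> R) :
  expm (bsecond_elt n s) = rot2 (extend0 s).
Proof.
rewrite /rot2 -expm_antisym; [|exact: mirrorK|exact: antisym_angle2].
congr expm; apply/matrixP => a b; rewrite /bsecond_elt summxE mxE.
have [an bn] := (ltn_ord a, ltn_ord b).
have -> : (mirror a == b) = (b == (if 0 < a then n - a else a)%N :> nat).
  by rewrite -(inj_eq val_inj) val_mirror eq_sym.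
transitivity (\sum_(k < l./2) s k *
    ((((a : nat) == k.+1) && (b == n - k.+1 :> nat)%N)%:R -
     (((a : nat) == (n - k.+1)%N) && (b == k.+1 :> nat)%N)%:R)).
  apply: eq_bigr => k _; rewrite !mxE eqSS; congr (_ * (_%:R - _%:R)).
    by congr nat_of_bool; lia.
  by congr nat_of_bool; lia.
rewrite /angle2 /=; case: (nat_of_ord a) an => [|c] an /=.
  rewrite mul0rn big1 // => k _.
  (* Row 0 is empty: a truncated difference equal to 0 would force b = k + 1 >= n. *)
  have -> : ((0 == n - k.+1) && (b == k.+1 :> nat))%N = false by lia.
  by rewrite subrr mulr0.
rewrite -!sum_delta -sumrB -sumrMnl; apply: eq_bigr => k _.
have -> : ((c.+1 == k.+1) && (b == n - k.+1 :> nat))%N =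
    (k == c :> nat) && (b == n - c.+1 :> nat)%N by lia.
have -> : ((c.+1 == n - k.+1) && (b == k.+1 :> nat))%N =
    (k == n - c.+2 :> nat)%N && (b == n - c.+1 :> nat)%N by lia.
by case: (_ == (n - c.+1)%N); rewrite ?andbT ?andbF ?subrr ?mulr0 // mulrBr !mulr_natr.
Qed.

End Tori.

(** * The descent on windows *)

Section Stitch.
Variables (R : realType) (n n2 n3 p q : nat).
Hypotheses (hn23 : n = (1 + n2 + n3)%N) (hpq : n = (p + q)%N).

Let single (j : nat) (x : R) (k : nat) : R := if k == j then x else 0.

(** Induction on m, a strict bound for p - j. The supports of x and h are recorded so that they
    commute with the rotations of the enclosing step; the vanishing conditions keep the angles
    within the ranges of b'' and b'. *)
Lemma herringbone m j : (p - j < m)%N -> (j <= n2)%N -> (j <= n3)%N ->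
  forall g : 'M[R[i]]_n, unitary g ->
    supported [pred a : 'I_n | (j <= a < n - j)%N] g ->
  exists x h s t,
    [/\ Lgrp n2 x /\ supported [pred a : 'I_n | (j < a < n - j)%N] x,
        Hgrp p h /\ supported [pred a : 'I_n | (j <= a < n - j)%N] h,
        forall k, ~~ [&& k < p, k < q, k < n2 & k < n3]%N || (k < j)%N -> s k = 0,
        forall k, ~~ [&& k < p, k < q, k <= n2 & k <= n3]%N || (k < j)%N -> t k = 0 &
        g = x *m cplx_mx (rot2 n s) *m cplx_mx (rot1 n t) *m h].
Proof.
have c1 : cplx_mx 1%:M = 1%:M :> 'M[R[i]]_n by exact: map_mx1.
elim: m j => [//|m IH] j pj jn2 jn3 g ug gj.
have [jpq|jpq] := boolP ((j < p) && (j < q))%N; last first.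
  (* If p <= j or n - j <= p, the window lies in one block of H and g itself serves as h. *)
  exists 1%:M, g, (fun=> 0), (fun=> 0); split=> //.
  - split; last exact: supported1.
    by split; [exact: unitary1|exact: block_diag1].
  - split=> //; split=> //; apply: block_diag_supported gj => a b /= Sa Sb.
    by rewrite /blockH; case: (ltnP a p); case: (ltnP b p) => //; lia.
  - by rewrite rot1_0 // rot2_0 // c1 !mul1mx.
have /andP[jp jq] := jpq.
have jn : (j < n)%N by lia.
pose i0 := Ordinal jn; pose e0 := rev_ord i0.
(* Cut the window at the boundary p of the blocks of H; e_j and e_(n-1-j) fall on opposite sides. *)
have [||||h1 [h2 [th [[uh1 h1S] [uh2 h2T] gB]]]] := @unitary_peel R n
   [pred a : 'I_n | (j <= a < p)%N] [pred a : 'I_n | (p <= a < n - j)%N]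
   i0 e0 g _ _ _ ug.
- by move=> a /=; lia.
- by rewrite /= leqnn.
- by rewrite /=; lia.
- by apply: supported_sub gj => a /=; lia.
pose h0 := h1 *m h2; pose t0 := single j th; pose B := cplx_mx (rot1 n t0).
have uh0 : unitary h0 by exact: unitaryM.
have Hh0 : Hgrp p h0.
  split=> //; apply: block_diagM.
    apply: block_diag_supported h1S => a b /= /andP[_ ap] /andP[_ bp].
    by rewrite /blockH ap bp.
  apply: block_diag_supported h2T => a b /= /andP[ap _] /andP[bp _].
  by rewrite /blockH !ltnNge ap bp.
have h0j : supported [pred a : 'I_n | (j <= a < n - j)%N] h0.
  apply: supportedM; [apply: supported_sub h1S|apply: supported_sub h2T] => a /=; lia.
have Bj : supported [pred a : 'I_n | (a == j :> nat) || (a == n - j.+1 :> nat)%N] B.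
  apply: supported_givens; first exact: antisym_angle1.
  move=> a /=; rewrite negb_or /angle1 /t0 /single /= => /andP[/negPf-> aj].
  by rewrite (_ : (n - a.+1 == j)%N = false) ?subrr //; have := ltn_ord a; lia.
have uB : unitary B by exact: unitary_rot1.
pose g1 := g *m h0 *m adjmx B.
have ug1 : unitary g1 by apply: unitaryM; [exact: unitaryM|exact: unitary_adjmx].
have g1j : supported [pred a : 'I_n | (j < a < n - j)%N] g1.
  have := gB (rot1 n t0) uB; rewrite -/B => gB'; apply: supported_sub (gB' _ _).
  - by move=> a /=; rewrite -(inj_eq val_inj) /=; lia.
  - by apply: supported_sub Bj => a /=; lia.
  - rewrite row_givens /angle1 /t0 /single eqxx /=.
    by rewrite (_ : (n - j.+1 == j)%N = false) ?subr0 //; lia.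
have gE : g = g1 *m B *m adjmx h0.
  by rewrite /g1 unitary_mulmxKV // unitary_mulmxK.
have Hh0' : Hgrp p (adjmx h0).
  by split; [exact: unitary_adjmx|exact: block_diag_adjmx (proj2 Hh0)].
have h0j' := supported_adjmx h0j.
have [jn23|jn23] := boolP ((j < n2) && (j < n3))%N; last first.
  (* Now j = n2 or j = n3, so the window (j, n - j) lies in one block of L. The angle t_j occurs
     without a matching s_j, which is why b' may have one generator more than b''. *)
  exists g1, (adjmx h0), (fun=> 0), t0; split=> //.
  - split=> //; split=> //; apply: block_diag_supported g1j => a b /= Sa Sb.
    rewrite /blockL.
    by case: (ltnP a 1); case: (ltnP b 1); case: (ltnP a (1 + n2));
      case: (ltnP b (1 + n2)) => //; lia.
  - by move=> k; rewrite /t0 /single; case: eqVneq => // ->; lia.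
  - by rewrite rot2_0 // c1 mulmx1.
have e1n : (j.+1 < n)%N by lia.
pose e1 := Ordinal e1n.
(* Passing to the adjoint turns column n-1-j into a row and left multiplication into right; the cut
   is now between the last two blocks of L. *)
have [||||k1 [k2 [ph [[uk1 k1S] [uk2 k2T] gC]]]] := @unitary_peel R n
   [pred a : 'I_n | (n2 < a < n - j)%N] [pred a : 'I_n | (j < a <= n2)%N]
   e0 e1 (adjmx g1) _ _ _ (unitary_adjmx ug1).
- by move=> a /=; lia.
- by rewrite /=; lia.
- by rewrite /=; lia.
- by apply: supported_adjmx; apply: supported_sub g1j => a /=; lia.
(* Row n-1-j is the second index of its pair, where [angle2] takes the value - s_j; hence the sign
   of [ph]. *)
pose k0 := k1 *m k2; pose s0 := single j (- ph); pose C := cplx_mx (rot2 n s0).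
have uk0 : unitary k0 by exact: unitaryM.
have Lk0 : Lgrp n2 k0.
  split=> //; apply: block_diagM.
    apply: block_diag_supported k1S => a b /= Sa Sb; rewrite /blockL.
    by case: (ltnP a 1); case: (ltnP b 1); case: (ltnP a (1 + n2));
      case: (ltnP b (1 + n2)) => //; lia.
  apply: block_diag_supported k2T => a b /= Sa Sb; rewrite /blockL.
  by case: (ltnP a 1); case: (ltnP b 1); case: (ltnP a (1 + n2));
    case: (ltnP b (1 + n2)) => //; lia.
have k0j : supported [pred a : 'I_n | (j < a < n - j)%N] k0.
  apply: supportedM; [apply: supported_sub k1S|apply: supported_sub k2T] => a /=; lia.
have Cj s' : supported [pred a : 'I_n | (a == j.+1 :> nat) || (a == n - j.+1 :> nat)%N]
    (cplx_mx (rot2 n (single j s'))).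
  apply: supported_givens; first exact: antisym_angle2.
  move=> a /=; rewrite negb_or /angle2 /single /=; have := ltn_ord a.
  case: (nat_of_ord a) => // k kn; rewrite eqSS => /andP[/negPf-> aj].
  by rewrite (_ : (n - k.+2 == j)%N = false) ?subrr //; lia.
have uC : unitary C by exact: unitary_rot2.
pose g2 := C *m adjmx k0 *m g1.
have ug2 : unitary g2.
  by apply: unitaryM => //; apply: unitaryM => //; exact: unitary_adjmx.
have g2j : supported [pred a : 'I_n | (j.+1 <= a < n - j.+1)%N] g2.
  have := gC (rot2 n s0) uC; rewrite -/C => gC'.
  rewrite -[g2]adjmxK; apply: supported_adjmx.
  rewrite /g2 (adjmxM _ g1) (adjmxM C) adjmxK mulmxA.
  apply: supported_sub (gC' _ _).
  - by move=> a /=; rewrite -(inj_eq val_inj) /=; lia.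
  - by apply: supported_sub (Cj _) => a /=; lia.
  - rewrite row_givens /angle2 /s0 /single /=.
    have -> : (n - j.+1 = (n - j.+2).+1)%N by lia.
    have -> : (n - (n - j.+2).+2 = j)%N by lia.
    rewrite eqxx (_ : (n - j.+2 == j)%N = false) ?sub0r ?opprK; last by lia.
    congr (_ + _ *: delta_mx 0 _); apply/val_inj; rewrite val_mirror /= ifT; lia.
have C'E : adjmx C = cplx_mx (rot2 n (single j ph)).
  rewrite adjmx_cplx /rot2 tr_givens; [|exact: mirrorK|exact: antisym_angle2].
  congr (cplx_mx (givens _ _)); apply/funext => a; rewrite /angle2 /s0 /single.
  by case: (val a) => [|k]; [rewrite oppr0|do 2 case: ifP => _; ring].
have [|||x [h [s [t [[[ux bx] xj] [[uh bh] hj] s0' t0' g2E]]]]] := IH j.+1 _ _ _ g2 ug2 g2j.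
- by lia.
- by lia.
- by lia.
(* Substitution gives g = k0 C^* x (rot2 s) (rot1 t) h B h0^*, where C^* is the rotation of angle
   [ph]. Moving C^* past x and B past h merges it with [rot2 s] and B with [rot1 t], so the angles
   add. *)
exists (k0 *m x), (h *m adjmx h0), (fun k => single j ph k + s k), (fun k => t k + t0 k).
have g1E : g1 = k0 *m adjmx C *m g2.
  have cancel (X Y Z : 'M[R[i]]_n) : unitary X -> unitary Y ->
      Z = Y *m adjmx X *m (X *m adjmx Y *m Z).
    by move=> uX uY; rewrite !mulmxA unitary_mulmxKV // uY mul1mx.
  exact: cancel.
have BE : cplx_mx (rot1 n t0) = B by [].
clearbody g2 g1 B C k0 h0.
split.
- split; first by split; [exact: unitaryM|apply: block_diagM => //; case: Lk0].
  by apply: supportedM => //; apply: supported_sub xj => a /=; lia.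
- split; first by split; [apply: unitaryM => //; exact: unitary_adjmx|apply: block_diagM => //; case: Hh0'].
  by apply: supportedM => //; apply: supported_sub hj => a /=; lia.
- move=> k kj; rewrite s0' ?addr0 /single; last by lia.
  by case: eqVneq kj => // ->; lia.
- move=> k kj; rewrite t0' ?add0r /t0 /single; last by lia.
  by case: eqVneq kj => // ->; lia.
- rewrite gE -rot2D -rot1D !cplx_mxM -C'E BE g1E g2E.
  (* C lives on {j+1, n-1-j} and B on {j, n-1-j}, both disjoint from the supports of x and h
     respectively. *)
  have xC : adjmx C *m x = x *m adjmx C.
    by rewrite C'E; apply: supported_comm (Cj _) xj => a /=; lia.
  have hB : B *m h = h *m B by apply: supported_comm Bj hj => a /=; lia.
  by rewrite !mulmxA -(mulmxA k0) xC !mulmxA -[in LHS](mulmxA _ h B) -hB !mulmxA.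
Qed.

End Stitch.

(** * The decomposition of the whole group *)

Lemma unitary_Bset (R : realType) (n l : nat) (b : 'M[R[i]]_n) :
  Bset l b -> unitary b.
Proof.
case=> x [y [[s ->] [[t ->] ->]]]; rewrite expm_bsecond expm_bprime.
by apply: unitaryM; [exact: unitary_rot2|exact: unitary_rot1].
Qed.

(* G = U(n) equals L B H. *)
Theorem theorem3p1 (R : realType) (n n2 n3 p q : nat)
  (hn2 : (0 < n2)%N) (hn3 : (0 < n3)%N) (hp : (0 < p)%N) (hq : (0 < q)%N)
  (hn23 : n = (1 + n2 + n3)%N) (hpq : n = (p + q)%N) :
  forall g : 'M[R[i]]_n,
    unitary g <->
    exists (x b h : 'M[R[i]]_n),
      [/\ Lgrp n2 x, Bset (lpar n2 n3 p q) b, Hgrp p h & g = x *m b *m h].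
Proof.
move=> g; split=> [ug|[x [b [h [[ux _] /unitary_Bset ub [uh _] ->]]]]]; last first.
  by apply: unitaryM => //; exact: unitaryM.
(* The descent starts at j = 0, where the window contains every index. *)
have [|x [h [s [t [[Lx _] [Hh _] s0 t0 gE]]]]] :=
    herringbone hn23 hpq (ltnSn (p - 0)) (leq0n _) (leq0n _) ug.
  by move=> a b /=; have [] := (ltn_ord a, ltn_ord b); lia.
exists x, (cplx_mx (rot2 n s) *m cplx_mx (rot1 n t)), h; split=> //; last first.
  by rewrite gE !mulmxA.
(* The angles vanish from [l/2] = min(p, q, n2, n3) and [(l+1)/2] = min(p, q, n2+1, n3+1) on, so
   restricting them to the index ranges of b'' and b' loses nothing. *)
have sE := @extend0_id R (lpar n2 n3 p q)./2 s.
have tE := @extend0_id R ((lpar n2 n3 p q).+1)./2 t.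
exists (cplx_mx (rot2 n s)), (cplx_mx (rot1 n t)); split; last split=> //.
  exists (fun k => s k); rewrite expm_bsecond sE // => k.
  by rewrite /lpar => kl; apply: s0; lia.
exists (fun k => t k); rewrite expm_bprime tE // => k.
by rewrite /lpar => kl; apply: t0; lia.
Qed.
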